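(* Let $n\geq 1$ be an integer and let $K:[0,+\infty[\to \mathbf{R}$ and $f_1,\dots,f_n:\mathbf{R}\to\mathbf{R}$ be $n+1$ continuous functions satisfying the following conditions: (a) $\inf_{t>0}\int_0^tK(s)\,ds<0$ and $\liminf_{t\to+\infty}\frac{\int_0^tK(s)\,ds}{t}>0$; (b) $\limsup_{|t|\to+\infty}\frac{\left|\int_0^tf_k(s)\,ds\right|}{t^2}<+\infty$ for each $k=1,\dots,n$; (c) for each $k=1,\dots,n$, the function $t\mapsto\int_0^tf_k(s)\,ds$ is odd and vanishes only at $0$. Then, for each $r>0$, there exists a number $\delta>0$ with the following property: for every $n$-tuple of continuous functions $g_1,\dots,g_n:\mathbf{R}\to\mathbf{R}$ satisfying $$\max_{1\leq k\leq n}\left(\sup_{t\in\mathbf{R}}\int_0^tg_k(s)\,ds-\inf_{t\in\mathbf{R}}\int_0^tg_k(s)\,ds\right)<\delta,$$ there exists $(\tilde\mu_1,\dots,\tilde\mu_n)\in\mathbf{R}^n$, with $\sum_{k=1}^n|\tilde\mu_k|^2<r^2$, such that the problem $$\begin{cases}-K\left(\sum_{m=1}^{n+1}|x_m-x_{m-1}|^2\right)(x_{k+1}-2x_k+x_{k-1})=g_k(x_k)+\tilde\mu_kf_k(x_k), & k=1,\dots,n,\\ x_0=x_{n+1}=0\end{cases}$$ has at least three solutions.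
   Context: A solution of the problem is a vector $(x_0,x_1,\dots,x_n,x_{n+1})\in\mathbf{R}^{n+2}$ with $x_0=x_{n+1}=0$ satisfying the displayed equation for every $k=1,\dots,n$; ''at least three solutions'' means at least three distinct such vectors. *)

(* Defs.v *)
From HB Require Import structures.
From mathcomp Require Import all_boot all_order all_algebra.
From mathcomp Require Import all_classical all_reals all_analysis.

Set Implicit Arguments.
Unset Strict Implicit.
Unset Printing Implicit Defensive.

Import Order.TTheory GRing.Theory Num.Theory.
Import numFieldNormedType.Exports.

Local Open Scope classical_set_scope.
Local Open Scope ring_scope.

(* The integral of f from 0 to t, oriented: it is minus the integral over
   [t, 0] when t < 0. *)
Definition int0 (R : realType) (f : R -> R) (t : R) : R :=
  if 0 <= t then Rintegral (@lebesgue_measure R) `[0, t] f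
  else - Rintegral (@lebesgue_measure R) `[t, 0] f.

(* The filter of the limits as |t| -> +oo. *)
Definition abs_infty_nbhs (R : realType) : set_system R :=
  filter_from [set: R] (fun M => [set t : R | M < `|t|]).

Arguments abs_infty_nbhs : clear implicits.

(* An index k : 'I_n stands for the mathematical index k + 1 in {1, ..., n},
   so g k and mu 0 k are attached to the coordinate x_(k+1); the coordinates of
   x themselves are numbered from 0 to n + 1. *)
Definition is_solution (R : realType) (n : nat) (K : R -> R)
    (f g : 'I_n -> R -> R) (mu : 'rV[R]_n) (x : 'rV[R]_n.+2) : Prop :=
  let X (m : nat) : R := x 0 (inord m) in
  [/\ X 0%N = 0, X n.+1 = 0 &
    forall k : 'I_n,
      - K (\sum_(1 <= m < n.+2) `|X m - X m.-1| ^+ 2)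
        * (X k.+2 - 2 * X k.+1 + X k)
      = g k (X k.+1) + mu 0 k * f k (X k.+1)].

(* Main.v *)
Require Import Defs.
From HB Require Import structures.
From mathcomp Require Import all_boot all_order all_algebra.
From mathcomp Require Import all_classical all_reals all_analysis.
From mathcomp Require Import ring lra.
Import Order.TTheory GRing.Theory Num.Theory.
Import numFieldNormedType.Exports.
Set Implicit Arguments.
Unset Strict Implicit.
Unset Printing Implicit Defensive.
Local Open Scope classical_set_scope.
Local Open Scope ring_scope.

(* With S(x) = sum |x_m - x_(m-1)|^2, Phi = int0 K, F_k = int0 (f k) and
   G_k = int0 (g k), the solutions are the critical points of
   E_mu(x) = Phi(S(x)) / 2 - sum_k (G_k(x_k) + mu_k F_k(x_k)), which is coercive
   when mu is small.  Suppose first that g = 0 and let m < 0 be the minimum of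
   I = Phi(S) / 2.  As I is even and F is odd, inf_x E_mu <= m for all mu, while
   the minimum over x of sup_(|mu| <= rho) E_mu = I + rho sum_k |F_k(x_k)|
   exceeds m, because F vanishes only at 0 and I(0) = 0.  This minimax gap
   survives a perturbation by small G_k.  If E_mu had a unique global minimizer
   for every mu in the cube |mu| <= rho, the minimizer at a mu maximizing
   min_x E_mu would be a saddle point and there would be no gap.  So some E_mu
   has two global minimizers, and a mountain pass argument yields a third
   critical point. *)

(** * Limits along filters and the inner product on row vectors *)

(** An ultrafilter finer than [\oo] plays the part of a convergent subsequence: a cluster point of
    [u @ G] is automatically its limit, and limits along [\oo] persist along [G]. *)
Lemma compact_seq_cvg (T : topologicalType) (A : set T) (u : nat -> T) :
  compact A -> (forall k, A (u k)) ->
  exists2 x, A x &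
    exists G : set_system nat, [/\ ProperFilter G, \oo `<=` G & u @ G --> x].
Proof.
move=> cA Au; have [G [GU ooG]] := ultraFilterLemma eventually_filter.
have [|x [Ax clx]] := cA (u @ G) _.
  by apply: (@filterS _ G _ setT) => [k _|]; [exact: Au|exact: filterT].
exists x => //; exists G; split => //; first exact: ultra_proper.
move=> B xB; have [//|GnB] := @in_ultra_setVsetC _ G (u @^-1` B) GU.
by have [y []] := clx (~` B) B GnB xB.
Qed.

Lemma cvg_sumr (T I : Type) (F : set_system T) {FF : Filter F} (R : realType)
    (r : seq I) (f : I -> T -> R) (l : I -> R) :
  (forall i, f i @ F --> l i) ->
  (fun t => \sum_(i <- r) f i t) @ F --> \sum_(i <- r) l i.
Proof.
move=> fl; elim: r => [|i r ih].
  rewrite big_nil; under eq_fun do rewrite big_nil; exact: cvg_cst.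
by rewrite big_cons; under eq_fun do rewrite big_cons; exact: cvgD.
Qed.

Definition dotp (R : realType) (n : nat) (u v : 'rV[R]_n) : R :=
  \sum_(k < n) u 0 k * v 0 k.

Lemma coord_norm (R : realType) (n : nat) (v : 'rV[R]_n) k : `|v 0 k| <= `|v|.
Proof.
rewrite [leRHS]/Num.norm /= mx_normrE; apply/bigmax_geP; right => /=.
by exists (0, k).
Qed.

Lemma norm_rV_le (R : realType) (n : nat) (v : 'rV[R]_n) (M : R) :
  0 <= M -> (forall k, `|v 0 k| <= M) -> `|v| <= M.
Proof.
move=> M0 vM; rewrite [leLHS]/Num.norm /= mx_normrE; apply/bigmax_leP; split => //.
by case=> i j _ /=; rewrite ord1.
Qed.

Lemma dotpDr (R : realType) (n : nat) (u v w : 'rV[R]_n) :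
  dotp u (v + w) = dotp u v + dotp u w.
Proof.
by rewrite /dotp -big_split; apply: eq_bigr => k _; rewrite mxE mulrDr.
Qed.

Lemma dotpZr (R : realType) (n : nat) a (u v : 'rV[R]_n) :
  dotp u (a *: v) = a * dotp u v.
Proof. by rewrite /dotp mulr_sumr; apply: eq_bigr => k _; rewrite mxE mulrCA. Qed.

Lemma dotpC (R : realType) (n : nat) (u v : 'rV[R]_n) : dotp u v = dotp v u.
Proof. by rewrite /dotp; apply: eq_bigr => k _; rewrite mulrC. Qed.

Lemma dotp_delta (R : realType) (n : nat) (u : 'rV[R]_n) k :
  dotp u (delta_mx 0 k) = u 0 k.
Proof.
rewrite /dotp (bigD1 k)//= big1 ?addr0 ?mxE ?eqxx ?mulr1// => i ik.
by rewrite mxE (negbTE ik) andbF mulr0.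
Qed.

Lemma dotp_le0_eq0 (R : realType) (n : nat) (u : 'rV[R]_n) :
  dotp u u <= 0 -> u = 0.
Proof.
move=> u0; apply/rowP => k; rewrite mxE; apply/eqP; rewrite -sqrf_eq0.
rewrite eq_le sqr_ge0 andbT (le_trans _ u0)// /dotp (bigD1 k)//= -expr2 lerDl.
by apply: sumr_ge0 => i _; rewrite -expr2 sqr_ge0.
Qed.

Lemma cvg_coord (R : realType) (n : nat) (T : Type) (F : set_system T)
    {FF : Filter F} (u : T -> 'rV[R]_n) (a : 'rV[R]_n) k :
  u @ F --> a -> (fun t => u t 0 k) @ F --> a 0 k.
Proof. by move=> ua; exact: (continuous_cvg _ (@coord_continuous R 1 n 0 k a) ua). Qed.

Lemma cvg_dotp (R : realType) (n : nat) (T : Type) (F : set_system T)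
    {FF : Filter F} (u v : T -> 'rV[R]_n) (a b : 'rV[R]_n) :
  u @ F --> a -> v @ F --> b -> (fun t => dotp (u t) (v t)) @ F --> dotp a b.
Proof. by move=> ua vb; apply: cvg_sumr => k; apply: cvgM; exact: cvg_coord. Qed.

(** * Directional derivatives and minimizers of coercive functions *)

(** Both difference quotients are the same function of the increment; this brings one-variable
    calculus to bear on [E] along a line. *)
Lemma is_derive_lineE (R : realType) (V : normedModType R) (E : V -> R) (z v : V)
    (s d : R) :
  is_derive s (1 : R) (fun t => E (z + t *: v)) d = is_derive (z + s *: v) v E d.
Proof.
have eqf : (fun h => h^-1 *: ((E \o shift (z + s *: v)) (h *: v) - E (z + s *: v)))
  = (fun h : R => h^-1 *: (((fun t => E (z + t *: v)) \o shift s) (h *: (1 : R))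
      - E (z + s *: v))).
  by apply/funext => h /=; rewrite scalerDl addrCA [h *: (1 : R)]mulr1.
by apply/propext; split=> -[]; rewrite /derivable /derive ?eqf => dE Ed; split;
  rewrite /derivable /derive ?eqf.
Qed.

Lemma bounded_sublevel_compact (R : realType) (n : nat) (E : 'rV[R]_n -> R) a M :
  continuous E -> (forall z, E z <= a -> `|z| <= M) ->
  compact [set z | E z <= a].
Proof.
move=> cE EM; apply: bounded_closed_compact.
  exists M; split; first exact: num_real.
  by move=> N MN z /= /EM /le_trans; apply; exact: ltW.
by apply: (preimage_closed _ (@closed_le _ _)) => y _; exact: cE.
Qed.

Lemma coercive_min (R : realType) (n : nat) (E : 'rV[R]_n -> R) :
  continuous E -> (forall a, exists M, forall z, E z <= a -> `|z| <= M) ->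
  exists z, forall w, E z <= E w.
Proof.
move=> cE coE; have [M EM] := coE (E 0).
have [||z _ zm] := @EVT_min_rV R n E [set z | E z <= E 0] _
  (@bounded_sublevel_compact _ _ _ _ _ cE EM).
- by exists 0 => /=.
- exact: continuous_subspaceT.
exists z => w; have [wE|/ltW] := leP (E w) (E 0); first by apply: zm; rewrite inE.
by apply: le_trans; apply: zm; rewrite inE/=.
Qed.

(** * A third critical point between two global minimizers *)

Section mountain_pass.
Variables (R : realType) (n : nat) (E : 'rV[R]_n -> R).
Variable dE : 'rV[R]_n -> 'rV[R]_n.
Hypothesis E_derive : forall z v, is_derive z v E (dotp (dE z) v).

Lemma grad_min z : (forall w, E z <= E w) -> dE z = 0.
Proof.
move=> zm; apply/rowP => k; rewrite mxE -dotp_delta.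
have d t : is_derive (t : R) (1 : R) (fun t => E (z + t *: delta_mx 0 k))
    (dotp (dE (z + t *: delta_mx 0 k)) (delta_mx 0 k)).
  by rewrite is_derive_lineE; exact: E_derive.
have l1 : (-1 : R) <= 1 by lra.
have i0 : (0 : R) \in `](-1), 1[ by rewrite in_itv/=; apply/andP; split; lra.
have [|_] := derive1_at_min l1 (fun t _ => @ex_derive _ _ _ _ _ _ _ (d t)) i0.
  by move=> t _; rewrite scale0r addr0.
by have [_] := d 0; rewrite scale0r addr0 => -> ->.
Qed.

Hypothesis E_continuous : continuous E.
Hypothesis dE_continuous : continuous dE.
Hypothesis E_coercive : forall a, exists M, forall z, E z <= a -> `|z| <= M.

(** The mean value theorem on the segment of one gradient descent step. *)
Lemma grad_step (eta : R) z : exists2 s : R, 0 <= s <= 1 &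
  E (z - eta *: dE z) - E z =
    - eta * dotp (dE (z - (s * eta) *: dE z)) (dE z).
Proof.
have d t : is_derive (t : R) (1 : R) (fun t => E (z + t *: (- eta *: dE z)))
    (dotp (dE (z + t *: (- eta *: dE z))) (- eta *: dE z)).
  by rewrite is_derive_lineE; exact: E_derive.
have [|s] := @MVT_segment R _ _ 0 1 ler01 (fun t _ => d t).
  apply: continuous_subspaceT => t.
  by apply: differentiable_continuous; apply/derivable1_diffP; case: (d t).
rewrite in_itv/= => s01; rewrite scale1r scale0r addr0 subr0 mulr1 dotpZr.
by rewrite scaleNr scalerN scalerA => ->; exists s.
Qed.

(* Let c be the infimum of the levels a such that some connected subset of
   {E <= a} contains x and y; a sphere around x separating it from y shows
   c > min E.  The map z |-> z - eta dE(z) fixes x and y and preserves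
   connectedness, so it cannot push a connected set at level c + eta^2 below
   c - eta^2; the points where it fails to do so accumulate, as eta -> 0, at a
   critical point of level c. *)
Lemma third_critical_point x y : x != y ->
  (forall z, E x <= E z) -> (forall z, E y <= E z) ->
  exists z, [/\ z != x, z != y & dE z = 0].
Proof.
move=> xy xm ym.
have Exy : E y = E x by apply/eqP; rewrite eq_le xm ym.
apply: contrapT => no3.
pose d := `|y - x|.
have d0 : 0 < d by rewrite normr_gt0 subr_eq0 eq_sym.
(* With half the distance as radius, [x] lies inside the sphere and [y] outside. *)
pose Sph := [set z : 'rV[R]_n | `|z - x| = d / 2].
have cnx : continuous (fun z : 'rV[R]_n => `|z - x|).
  by move=> z; exact: (cvg_norm (cvgB cvg_id (cvg_cst x))).
have Sph_c : compact Sph.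
  apply: bounded_closed_compact.
    exists (d / 2 + `|x|); split; first exact: num_real.
    move=> N MN z /= zS; apply: le_trans (ltW MN).
    by rewrite -zS -{1}(subrK x z) ler_normD.
  apply: (preimage_closed _ (@closed_eq R (d / 2))).
  by move=> z _; exact: cnx.
have Sph0 : Sph !=set0.
  exists (x + 2^-1 *: (y - x)); rewrite /Sph/= addrC addKr normrZ -/d.
  by rewrite ger0_norm// mulrC.
have [|w] := @EVT_min_rV R n E Sph Sph0 Sph_c; first exact: continuous_subspaceT.
rewrite inE => wS wm.
(* Equality would make [w] a global minimizer, hence a third critical point: it is at distance
   [d / 2] from [x], so it is neither [x] nor [y]. *)
have Ew : E x < E w.
  rewrite lt_neqAle xm andbT; apply/negP => /eqP Exw; apply: no3; exists w.
  split; last by apply: grad_min => z; rewrite -Exw.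
    apply/eqP => wx; move: wS; rewrite /Sph/= wx subrr normr0 => ?; lra.
  apply/eqP => wy; move: wS; rewrite /Sph/= wy -/d => ?; lra.
pose S := [set a | exists C : set 'rV[R]_n,
  [/\ connected C, C x, C y & forall z, C z -> E z <= a]].
(* The distance to [x] maps a connected set through [x] and [y] onto an interval containing 0 and
   [d], so the set meets the sphere. *)
have S_ge a : S a -> E w <= a.
  move=> [C [Cc Cx Cy CE]].
  have /connected_intervalP CI : connected ((fun z => `|z - x|) @` C).
    by apply: connected_continuous_connected => //; exact: continuous_subspaceT.
  have [||//|z Cz zd] := CI 0 d _ _ (d / 2).
  - by exists x => //; rewrite subrr normr0.
  - by exists y.
  - by apply/andP; split; lra.
  by apply: le_trans (CE _ Cz); apply: wm; rewrite inE.
have S0 : S !=set0.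
  pose C := (fun s : R => x + s *: (y - x)) @` `[0, 1].
  have cs : continuous (fun s : R => x + s *: (y - x)).
    move=> s; apply: cvgD; first exact: cvg_cst.
    by apply: cvgZr_tmp; exact: cvg_id.
  have [||s _ sm] := @EVT_max R (fun s => E (x + s *: (y - x))) 0 1 => //.
    apply: continuous_subspaceT => s; apply: continuous_comp; first exact: cs.
    exact: E_continuous.
  exists (E (x + s *: (y - x))), C; split.
  - apply: connected_continuous_connected; last exact: continuous_subspaceT.
    exact: segment_connected.
  - by exists 0; rewrite ?scale0r ?addr0//= in_itv/= lexx ler01.
  - by exists 1; rewrite ?scale1r ?subrKC//= in_itv/= lexx ler01.
  - by move=> _ [t t01 <-]; exact: sm.
have infS : has_inf S by split => //; exists (E w); exact: S_ge.
pose c := inf S.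
have cw : E w <= c by apply: lb_le_inf.
pose eta k : R := harmonic k.
have eta0 k : 0 < eta k by exact: harmonic_gt0.
have eta1 k : eta k <= 1.
  by rewrite /eta /harmonic/= invf_le1 ?ltr0n// ler1n.
have zex k : exists z, E z < c + eta k ^+ 2 /\
    c - eta k ^+ 2 < E (z - eta k *: dE z).
  have [a [C [Cc Cx Cy CE]] ac] : exists2 a, S a & a < c + eta k ^+ 2.
    by apply: inf_adherent => //; rewrite exprn_gt0.
  apply: contrapT => noz.
  pose T (z : 'rV[R]_n) := z - eta k *: dE z.
  have cT : continuous T.
    by move=> z; exact: (cvgB cvg_id (cvgZ (cvg_cst (eta k)) (@dE_continuous z))).
  suff : c <= c - eta k ^+ 2 by have := exprn_gt0 2 (eta0 k); lra.
  apply: ge_inf; first by case: infS.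
  exists (T @` C); split.
  - by apply: connected_continuous_connected => //; exact: continuous_subspaceT.
  - by exists x => //; rewrite /T grad_min// scaler0 subr0.
  - by exists y => //; rewrite /T grad_min// scaler0 subr0.
  - move=> _ [z Cz <-]; rewrite leNgt; apply/negP => cT'; apply: noz.
    by exists z; split => //; apply: le_lt_trans ac; exact: CE.
have [z zP] := choice zex.
(* [s k] is the mean value parameter of the step from [z k]; the hole stands for the identity
   supplied by [grad_step]. *)
have /choice[s sP] : forall k, exists s, 0 <= s <= 1 /\ _ :=
  fun k => let: ex_intro2 s s01 sE := grad_step (eta k) (z k) in
  ex_intro _ s (conj s01 sE).
have [M EM] := E_coercive (c + 1).
have [|z0 _ [G [GP ooG zG]]] :=
    @compact_seq_cvg _ _ z (bounded_sublevel_compact E_continuous EM).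
  move=> k /=; apply: ltW; apply: lt_le_trans (zP k).1 _.
  by rewrite lerD2l expr_le1// ltW.
have etaG : eta @ G --> 0.
  by apply: cvg_trans cvg_harmonic => B /ooG.
have eta2G : (fun k => eta k ^+ 2) @ G --> (0 : R).
  by rewrite -(mulr0 (0 : R)); exact: (cvgM etaG etaG).
have dEG : (dE \o z) @ G --> dE z0.
  exact: (continuous_cvg _ (@dE_continuous z0) zG).
have seta : (fun k => s k * eta k) @ G --> (0 : R).
  apply: norm_cvg0; apply: (squeeze_cvgr _ (cvg_cst 0) etaG).
  near=> k; have [/andP[s0 s1] _] := sP k.
  rewrite normr_ge0/= ger0_norm; last by rewrite mulr_ge0// ltW.
  by rewrite ler_piMl// ltW.
have step (a : nat -> R) : a @ G --> (0 : R) ->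
    (fun k => z k - a k *: dE (z k)) @ G --> z0.
  move=> aG; rewrite -[z0 in X in _ --> X]subr0 -(scale0r (dE z0)).
  have aE : (fun k => a k *: dE (z k)) @ G --> 0 *: dE z0.
    exact: (cvgZ aG dEG).
  exact: (cvgB zG aE).
(* By the choice of [z k], a step lowers [E] by less than [2 * eta k ^+ 2]; dividing the mean value
   identity by [eta k] bounds the inner product by [2 * eta k], which tends to 0. *)
have dz0 : dE z0 = 0.
  apply: dotp_le0_eq0.
  have lhs : (fun k => dotp (dE (z k - (s k * eta k) *: dE (z k))) (dE (z k)))
      @ G --> dotp (dE z0) (dE z0).
    apply: cvg_dotp dEG.
    exact: (continuous_cvg _ (@dE_continuous z0) (step _ seta)).
  have rhs : (fun k => 2 * eta k) @ G --> (0 : R).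
    by rewrite -[0 in X in _ --> X](mulr0 2); apply: cvgM etaG; exact: cvg_cst.
  apply: (ler_cvg_to lhs rhs); near=> k.
  have [_ eqE] := sP k; have [z1 z2] := zP k; have e0 := eta0 k.
  rewrite -(ler_pM2l e0); move: eqE; lra.
have Ez0 : E z0 >= c.
  have lhs : (fun k => c - eta k ^+ 2) @ G --> c.
    by rewrite -[c in X in _ --> X]subr0; exact: (cvgB (cvg_cst c) eta2G).
  have rhs : (fun k => E (z k - eta k *: dE (z k))) @ G --> E z0.
    exact: (continuous_cvg _ (@E_continuous z0) (step _ etaG)).
  by apply: (ler_cvg_to lhs rhs); near=> k; apply: ltW; exact: (zP k).2.
(* [E z0 >= c >= E w > E x = E y], so [z0] is neither minimizer. *)
apply: no3; exists z0; split => //; apply/eqP => zx; move: Ez0; rewrite zx; lra.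
Unshelve. all: by end_near. Qed.

End mountain_pass.

(** * Minimax: a parameter with two global minimizers *)

Lemma compact_norm_le (R : realType) (n : nat) (M : R) :
  compact [set z : 'rV[R]_n | `|z| <= M].
Proof.
by apply: (bounded_sublevel_compact (M := M)) => // z; exact: norm_continuous.
Qed.

Section two_minimizers.
Variables (R : realType) (n : nat) (I : 'rV[R]_n -> R) (P : 'rV[R]_n -> 'rV[R]_n).
Variables (rho v : R).
Hypothesis rho0 : 0 < rho.
Hypothesis I_continuous : continuous I.
Hypothesis P_continuous : continuous P.

Let h (mu x : 'rV[R]_n) := I x - dotp mu (P x).

Hypothesis h_coercive : forall a, exists M, forall mu x,
  `|mu| <= rho -> h mu x <= a -> `|x| <= M.
Hypothesis v_ge : forall mu, `|mu| <= rho -> exists x, h mu x <= v.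
Hypothesis v_lt : forall x, v < I x + rho * \sum_(k < n) `|P x 0 k|.

Let h_cvg (T : Type) (F : set_system T) {FF : Filter F} (m u : T -> 'rV[R]_n)
    (m0 u0 : 'rV[R]_n) :
  m @ F --> m0 -> u @ F --> u0 -> (fun t => h (m t) (u t)) @ F --> h m0 u0.
Proof.
move=> mm uu; apply: cvgB; first exact: (continuous_cvg _ (@I_continuous u0) uu).
by apply: cvg_dotp mm _; exact: (continuous_cvg _ (@P_continuous u0) uu).
Qed.

(** If every [h mu] had a single minimizer [xm mu], take [mu0] maximizing the minimal value [V].
    Uniqueness forces minimizers at parameters tending to [mu0] to accumulate at [x0 = xm mu0];
    maximality of [V mu0] along the segment to a suitable [nu] then gives [h nu x0 <= V mu0 <= v],
    against [v_lt]. *)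
Lemma two_minimizers : exists2 mu : 'rV[R]_n, `|mu| <= rho &
  exists x y, [/\ x != y, forall z, h mu x <= h mu z & forall z, h mu y <= h mu z].
Proof.
apply: contrapT => no2.
have uniq mu x y : `|mu| <= rho -> (forall z, h mu x <= h mu z) ->
    (forall z, h mu y <= h mu z) -> x = y.
  move=> muQ xm ym; apply/eqP/negPn/negP => xy; apply: no2.
  by exists mu => //; exists x, y.
have /choice[xm xmP] mu : exists x, `|mu| <= rho -> forall z, h mu x <= h mu z.
  have [muQ|] := leP `|mu| rho; last by exists 0.
  have [|a|x xm] := @coercive_min R n (h mu); last by exists x.
    move=> z; apply: (@h_cvg _ (nbhs z) _ (fun=> mu) id mu z); first exact: cvg_cst.
    exact: cvg_id.
  by have [M hM] := h_coercive a; exists M => z; exact: hM.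
pose V mu := h mu (xm mu).
have Vv mu : `|mu| <= rho -> V mu <= v.
  by move=> muQ; have [x xv] := v_ge muQ; apply: le_trans xv; exact: xmP.
pose eta k : R := harmonic k.
have eta0 k : 0 < eta k by exact: harmonic_gt0.
have eta1 k : eta k <= 1 by rewrite /eta /harmonic/= invf_le1 ?ltr0n// ler1n.
(* As a minimum of functions continuous in [mu], [V] is upper semicontinuous: testing
   near-maximizing parameters [m k] at the fixed point [xm mu0] bounds the supremum by [V mu0]. *)
have [mu0 mu0Q Vmax] : exists2 mu0, `|mu0| <= rho &
    forall mu, `|mu| <= rho -> V mu <= V mu0.
  pose A := V @` [set mu | `|mu| <= rho].
  have supA : has_sup A.
    split; first by exists (V 0), 0 => //=; rewrite normr0 ltW.
    by exists v => _ [mu muQ <-]; exact: Vv.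
  have /choice[m mP] k : exists mu, `|mu| <= rho /\ sup A - eta k < V mu.
    have [_ [mu muQ <-] ?] := sup_adherent (eta0 k) supA.
    by exists mu.
  have [k /=|mu0 mu0Q [G [GP ooG mG]]] := compact_seq_cvg (@compact_norm_le R n rho)
    (u := m); first exact: (mP k).1.
  exists mu0 => // mu muQ.
  have -> // : V mu <= sup A -> V mu <= V mu0.
    move/le_trans; apply.
    have etaG : eta @ G --> 0 by apply: cvg_trans cvg_harmonic => B /ooG.
    have lhs : (fun k => sup A - eta k) @ G --> sup A.
      by rewrite -[sup A in X in _ --> X]subr0; exact: (cvgB (cvg_cst _) etaG).
    have rhs : (fun k => h (m k) (xm mu0)) @ G --> V mu0.
      by apply: h_cvg => //; exact: cvg_cst.
    apply: (ler_cvg_to lhs rhs); near=> k.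
    by have [mQ /ltW/le_trans] := mP k; apply; exact: xmP.
  by apply: sup_upper_bound => //; exists mu.
pose x0 := xm mu0.
(* A point of the cube where [h _ x0] is largest: the max norm lets each coordinate be chosen
   separately, with sign opposite to that of [P x0]. *)
pose nu : 'rV[R]_n := \row_k (- (rho * Num.sg (P x0 0 k))).
have nuQ : `|nu| <= rho.
  apply: norm_rV_le; first exact: ltW.
  move=> k; rewrite mxE normrN normrM gtr0_norm// ler_piMr ?(ltW rho0)//.
  by rewrite normr_sg; case: (_ == 0).
have hnu : h nu x0 = I x0 + rho * \sum_(k < n) `|P x0 0 k|.
  rewrite /h /dotp; congr (_ + _); rewrite -sumrN mulr_sumr.
  by apply: eq_bigr => k _; rewrite mxE mulNr opprK -mulrA -normrEsg.
pose m k := mu0 + eta k *: (nu - mu0).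
have mQ k : `|m k| <= rho.
  have -> : m k = (1 - eta k) *: mu0 + eta k *: nu.
    by rewrite /m scalerBr scalerBl scale1r -addrA [- _ + _]addrC.
  rewrite (le_trans (ler_normD _ _))// !normrZ.
  rewrite !ger0_norm ?subr_ge0// ?(ltW (eta0 k))//.
  have e0 := eta0 k; have e1 := eta1 k.
  have h1 : (1 - eta k) * `|mu0| <= (1 - eta k) * rho.
    by apply: ler_wpM2l => //; lra.
  have h2 : eta k * `|nu| <= eta k * rho by apply: ler_wpM2l => //; lra.
  lra.
have [M hM] := h_coercive v.
have [k /=|x1 _ [G [GP ooG xG]]] := compact_seq_cvg (@compact_norm_le R n M)
  (u := xm \o m); first by apply: hM (mQ k) _; exact: Vv.
have etaG : eta @ G --> 0 by apply: cvg_trans cvg_harmonic => B /ooG.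
have mG : m @ G --> mu0.
  rewrite -[mu0 in X in _ --> X]addr0 -(scale0r (nu - mu0)).
  apply: cvgD; first exact: cvg_cst.
  by apply: cvgZ etaG _; exact: cvg_cst.
(* Minimality passes to the limit, so [x1] minimizes [h mu0] and uniqueness applies. *)
have x1E : x1 = x0.
  apply: (uniq mu0) => //; last exact: xmP.
  move=> w.
  have lhs : (fun k => h (m k) (xm (m k))) @ G --> h mu0 x1 by exact: h_cvg mG xG.
  have rhs : (fun k => h (m k) w) @ G --> h mu0 w by exact: h_cvg mG (cvg_cst w).
  by apply: (ler_cvg_to lhs rhs); near=> k; exact: xmP.
have hmu (mu x : 'rV[R]_n) : h mu x = h mu0 x - dotp (mu - mu0) (P x).
  rewrite /h (dotpC (mu - mu0)) dotpDr -(scaleN1r mu0) dotpZr !(dotpC (P x)).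
  lra.
(* [V (m k) <= V mu0 <= h mu0 (xm (m k))], and the outer terms differ by [eta k] times the inner
   product of [nu - mu0] with [P (xm (m k))]. That product is thus nonnegative, and so is its
   limit. *)
have ge0 : 0 <= dotp (nu - mu0) (P x0).
  have rhs : (fun k => dotp (nu - mu0) (P (xm (m k)))) @ G --> dotp (nu - mu0) (P x1).
    apply: cvg_dotp; first exact: cvg_cst.
    exact: (continuous_cvg _ (@P_continuous x1) xG).
  rewrite -x1E; apply: (ler_cvg_to (cvg_cst 0) rhs); near=> k.
  have := Vmax _ (mQ k); rewrite /V (hmu (m k)).
  have a0 := xmP _ mu0Q (xm (m k)).
  have -> : m k - mu0 = eta k *: (nu - mu0) by rewrite /m addrC addKr.
  rewrite dotpC dotpZr dotpC => a1.
  by rewrite -(pmulr_rge0 _ (eta0 k)); lra.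
have := v_lt x0; rewrite -hnu hmu; have := Vv _ mu0Q; rewrite /V -/x0; lra.
Unshelve. all: by end_near. Qed.

End two_minimizers.

(** * The oriented integral as a primitive *)

Lemma near_is_derive (R : realType) (f g : R -> R) (t d : R) :
  (\forall s \near t, f s = g s) -> is_derive t (1 : R) g d ->
  is_derive t (1 : R) f d.
Proof.
move=> fg [dg gd].
have fgd : (fun h => h^-1 *: ((f \o shift t) (h *: (1 : R)) - f t)) @ (0 : R)^' --> d.
  rewrite -gd; apply: cvg_trans dg; apply: near_eq_cvg.
  have ft : f t = g t by exact: nbhs_singleton fg.
  move: fg; rewrite (near_shift 0) => fg; apply: cvg_within; near=> h.
  rewrite /= ft; congr (_ *: (_ - _)); rewrite [h *: (1 : R)]mulr1.
  apply/esym; near: h; apply: filterS fg => h /=; rewrite subr0; exact.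
split; last by rewrite /derive; exact: cvg_lim fgd.
by rewrite /derivable; apply/cvg_ex; exists d.
Unshelve. all: by end_near. Qed.

Lemma continuous_integrable_itv (R : realType) (f : R -> R) (a b : R) :
  continuous f -> (@lebesgue_measure R).-integrable `[a, b] (EFin \o f).
Proof.
move=> cf; apply: continuous_compact_integrable; first exact: segment_compact.
exact: continuous_subspaceT.
Qed.

(** Moving the base point to [- N] merges the two sign cases of [int0] into one integral with
    variable upper end, the form needed by the fundamental theorem of calculus. *)
Lemma int0_itv (R : realType) (f : R -> R) (N y : R) :
  continuous f -> 0 <= N -> - N <= y ->
  int0 f y = Rintegral (@lebesgue_measure R) `[- N, y] f
             - Rintegral (@lebesgue_measure R) `[- N, 0] f.
Proof.
move=> cf N0 Ny; rewrite /int0.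
have mf (a b : R) : (@lebesgue_measure R).-integrable `]a, b] (EFin \o f).
  apply: integrableS (continuous_integrable_itv a b cf) => //.
  exact: subset_itv_oc_cc.
have [y0|y0] := leP 0 y.
  rewrite Rintegral_itvB ?bnd_simp//; last 2 first.
  - exact: continuous_integrable_itv.
  - lra.
  by rewrite Rintegral_itv_obnd_cbnd.
rewrite -opprB Rintegral_itvB ?bnd_simp//; last 2 first.
- exact: continuous_integrable_itv.
- exact: ltW.
by rewrite Rintegral_itv_obnd_cbnd.
Qed.

Lemma int0_0 (R : realType) (f : R -> R) : int0 f 0 = 0.
Proof. by rewrite /int0 lexx set_itv1 Rintegral_set1. Qed.

Lemma int0_derive (R : realType) (f : R -> R) (t : R) :
  continuous f -> is_derive t (1 : R) (int0 f) (f t).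
Proof.
move=> cf; pose N := `|t| + 1.
have N0 : 0 <= N by rewrite addr_ge0.
have Nt : - N < t by rewrite /N; have := ler_norm (- t); rewrite normrN; lra.
pose F y := Rintegral (@lebesgue_measure R) `[- N, y] f.
apply: (@near_is_derive _ _ (F \- cst (F 0))).
  near=> y; rewrite (int0_itv (N := N))//.
  by apply: ltW; near: y; exact: lt_nbhsr.
have tu : t < t + 1 by rewrite ltrDl.
have [dF Ft] := continuous_FTC1_closed tu (continuous_integrable_itv _ _ cf) Nt (cf t).
rewrite -(subr0 (f t)); apply: is_deriveB.
by split; [exact: dF|rewrite -Ft derive1E].
Unshelve. all: by end_near. Qed.

Lemma int0_continuous (R : realType) (f : R -> R) :
  continuous f -> continuous (int0 f).
Proof.
move=> cf t; apply: differentiable_continuous; apply/derivable1_diffP.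
by have [] := int0_derive t cf.
Qed.

Lemma continuous_comp_norm (R : realType) (K : R -> R) :
  {within `[0, +oo[, continuous K} -> continuous (fun t : R => K `|t|).
Proof.
move=> /subspace_continuousP cK t.
have m0 s : `[0, +oo[%classic `|s : R| by rewrite /= in_itv/= andbT.
have cm := @norm_continuous _ _ t.
apply: cvg_trans (cK _ (m0 t)) => B /= /cm.
by apply: (@filterS _ (nbhs t)) => s /=; apply; exact: m0.
Qed.

Lemma int0_comp_norm (R : realType) (K : R -> R) (t : R) :
  0 <= t -> int0 (fun s => K `|s|) t = int0 K t.
Proof.
move=> t0; rewrite /int0 t0; apply: eq_Rintegral => s; rewrite inE/= in_itv/=.
by move=> /andP[s0 _]; rewrite ger0_norm.
Qed.

(** * Growth and oscillation bounds *)

Lemma limf_einf_gt0_bound (R : realType) (f : R -> R) :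
  (0 < limf_einf (fun t : R => (f t / t)%:E) (pinfty_nbhs R))%E ->
  exists2 c : R, 0 < c & exists T : R, forall t, T < t -> c * t <= f t.
Proof.
rewrite limf_einfE => /ereal_sup_gt[_ [V [M [Mreal MV]] <-]] Vinf.
(* The infimum is taken in the extended reals; should it be [+oo], the slope 1 serves. *)
have [c c0 cV] : exists2 c : R, 0 < c & (c%:E <= ereal_inf [set (f t / t)%:E | t in V])%E.
  case: (ereal_inf _) Vinf => [r||//]; first by rewrite lte_fin; exists r.
  by exists 1 => //; rewrite leey.
exists c => //; exists (Num.max M 0) => t; rewrite gt_max => /andP[/MV Vt t0].
rewrite -ler_pdivlMr// -lee_fin (le_trans cV)//.
by apply: ereal_inf_lbound; exists t.
Qed.

Lemma limf_esup_lty_bound (R : realType) (f : R -> R) :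
  (limf_esup (fun t : R => (`|f t| / t ^+ 2)%:E) (abs_infty_nbhs R) < +oo)%E ->
  exists2 C : R, 0 <= C & exists M : R, forall t, M < `|t| -> `|f t| <= C * t ^+ 2.
Proof.
rewrite limf_esupE => /ereal_inf_lt[_ [V [M _ MV]] <-] Vsup.
have [C C0 CV] : exists2 C : R, 0 <= C &
    (ereal_sup [set (`|f t| / t ^+ 2)%:E | t in V] <= C%:E)%E.
  case: (ereal_sup _) Vsup => [r _|//|_]; last by exists 0 => //; rewrite leNye.
  by exists `|r| => //; rewrite lee_fin ler_norm.
exists C => //; exists (Num.max M 0) => t; rewrite gt_max => /andP[/MV Vt t0].
rewrite -ler_pdivrMr; last by rewrite exprn_even_gt0//= -normr_gt0.
by rewrite -lee_fin; apply: le_trans CV; apply: ereal_sup_ubound; exists t.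
Qed.

Lemma quadratic_bound (R : realType) (f : R -> R) : continuous f ->
  (limf_esup (fun t : R => (`|f t| / t ^+ 2)%:E) (abs_infty_nbhs R) < +oo)%E ->
  exists2 C : R, 0 <= C & forall t, `|f t| <= C * (t ^+ 2 + 1).
Proof.
move=> cf /limf_esup_lty_bound[C C0 [M CM]].
have cn : continuous (fun t => `|f t|).
  by move=> t; exact: (continuous_comp (@cf t) (@norm_continuous _ _ _)).
have M0 : - `|M| <= `|M| by rewrite (@le_trans _ _ 0)// oppr_le0.
have [|a _ aM] := @EVT_max R (fun t => `|f t|) _ _ M0.
  exact: continuous_subspaceT.
have t2 t : 0 <= (t : R) ^+ 2 by exact: sqr_ge0.
(* [C] handles large [|t|]; the maximum [|f a|] handles the compact interval, where the added 1
   absorbs it. *)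
exists (C + `|f a|) => [|t]; first by rewrite addr_ge0.
have a0 := normr_ge0 (f a).
have [tM|/aM tM] : M < `|t| \/ t \in `[- `|M|, `|M|]%R.
  have [|tM] := ltP M `|t|; first by left.
  by right; rewrite in_itv/= -ler_norml (le_trans tM)// ler_norm.
- have /le_trans := CM _ tM; apply.
  have := t2 t; nra.
- have := t2 t; nra.
Qed.

Lemma linear_lower_bound (R : realType) (f : R -> R) (c T : R) :
  continuous f -> 0 < c -> (forall t, T < t -> c * t <= f t) ->
  exists D : R, forall t, 0 <= t -> c * t - D <= f t.
Proof.
move=> cf c0 cT.
have T0 : 0 <= `|T| by [].
have [|a _ aT] := @EVT_min R f _ _ T0; first exact: continuous_subspaceT.
have a0 := normr_ge0 (f a); have := ler_norm (- f a); rewrite normrN => a1.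
exists (c * `|T| + `|f a|) => t t0.
have [/cT|tT] := ltP T t; first by have := mulr_ge0 (ltW c0) T0; lra.
have tT' : t <= `|T| by rewrite (le_trans tT)// ler_norm.
have := aT t; rewrite in_itv/= t0 tT' => /(_ isT) fat.
have : c * t <= c * `|T| by rewrite ler_pM2l.
lra.
Qed.

(** Since [int0 (g k)] vanishes at 0, its oscillation also bounds its absolute value. *)
Lemma oscillation_bound (R : realType) (n : nat) (g : 'I_n -> R -> R) (delta : R) :
  (\big[maxe/-oo]_(k < n)
     (ereal_sup [set (int0 (g k) t)%:E | t in [set: R]]
      - ereal_inf [set (int0 (g k) t)%:E | t in [set: R]]) < delta%:E)%E ->
  forall k t, `|int0 (g k) t| <= delta.
Proof.
move=> gd k.
have diff s t : int0 (g k) s - int0 (g k) t <= delta.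
  rewrite -lee_fin; apply: ltW; apply: le_lt_trans gd.
  apply: le_trans (le_bigmax _ _ k); rewrite EFinB; apply: leeB.
    by apply: ereal_sup_ubound; exists s.
  by apply: ereal_inf_lbound; exists t.
move=> t; have := diff t 0; have := diff 0 t; rewrite int0_0 => a b.
by rewrite ler_norml; apply/andP; split; lra.
Qed.

(** * The discrete Dirichlet energy and the functional of the problem *)

(** The discrete Green formula; the boundary terms drop out when [V] vanishes at 0 and [n.+1]. *)
Lemma summation_by_parts (R : comRingType) (n : nat) (Z V : nat -> R) :
  \sum_(m < n.+1) (Z m.+1 - Z m) * (V m.+1 - V m) =
  (Z n.+1 - Z n) * V n.+1 - (Z 1%N - Z 0%N) * V 0%N
  - \sum_(k < n) (Z k.+2 - 2 * Z k.+1 + Z k) * V k.+1.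
Proof.
elim: n => [|n ih]; first by rewrite big_ord_recr !big_ord0 /=; ring.
by rewrite big_ord_recr /= ih big_ord_recr /=; ring.
Qed.

Lemma is_derive_affine (R : realType) (a b t : R) :
  is_derive t (1 : R) (fun s : R => a + s * b) b.
Proof.
have d := is_deriveD (is_derive_cst a t (1 : R))
  (is_deriveM (is_derive_id t (1 : R)) (is_derive_cst b t (1 : R))).
by apply: (is_derive_eq d); rewrite scaler0 !add0r; exact: mulr1.
Qed.

Lemma is_derive_quadratic (R : realType) (a b c : R) :
  is_derive (0 : R) (1 : R) (fun s : R => a + s * b + s ^+ 2 * c) b.
Proof.
have d := is_deriveD (is_derive_affine a b 0) (is_deriveM
  (is_deriveM (is_derive_id (0 : R) (1 : R)) (is_derive_id (0 : R) (1 : R)))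
  (is_derive_cst c (0 : R) (1 : R))).
apply: (is_derive_eq d).
by rewrite !scaler0 add0r scale0r addr0 scaler0 addr0.
Qed.

Section dirichlet_energy.
Variables (R : realType) (n : nat).
Implicit Types z v : 'rV[R]_n.

(* Extension of a vector to all indices by the boundary values
   x_0 = x_(n+1) = 0. *)
Definition zero_ext z (m : nat) : R :=
  if m is i.+1 then oapp (z 0) 0 (insub i) else 0.

Arguments zero_ext : simpl never.

Lemma zero_ext_ord z (k : 'I_n) : zero_ext z k.+1 = z 0 k.
Proof. by rewrite /zero_ext valK. Qed.

Lemma zero_ext_last z : zero_ext z n.+1 = 0.
Proof. by rewrite /zero_ext insubN ?ltnn. Qed.

Lemma zero_ext_line z v (s : R) m :
  zero_ext (z + s *: v) m = zero_ext z m + s * zero_ext v m.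
Proof.
rewrite /zero_ext; case: m => [|i] /=; first by rewrite mulr0 addr0.
by case: insub => [k|] /=; rewrite ?mxE// mulr0 addr0.
Qed.

Definition dirichlet z : R :=
  \sum_(m < n.+1) (zero_ext z m.+1 - zero_ext z m) ^+ 2.

Definition neg_laplacian z : 'rV[R]_n :=
  \row_k - (zero_ext z k.+2 - 2 * zero_ext z k.+1 + zero_ext z k).

(** [dirichlet] is a quadratic form whose polar form, by summation by parts, is the inner product
    with [neg_laplacian]; the linear coefficient in [s] gives its gradient. *)
Lemma dirichlet_line z v (s : R) :
  dirichlet (z + s *: v) =
  dirichlet z + s * (2 * dotp (neg_laplacian z) v) + s ^+ 2 * dirichlet v.
Proof.
have -> : dotp (neg_laplacian z) v = \sum_(m < n.+1)
    (zero_ext z m.+1 - zero_ext z m) * (zero_ext v m.+1 - zero_ext v m).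
  rewrite summation_by_parts !zero_ext_last !mulr0 subrr sub0r -sumrN.
  by apply: eq_bigr => k _; rewrite mxE mulNr (zero_ext_ord v).
rewrite /dirichlet !mulr_sumr -!big_split/=.
by apply: eq_bigr => m _; rewrite !zero_ext_line; ring.
Qed.

Lemma dirichlet_ge0 z : 0 <= dirichlet z.
Proof. by apply: sumr_ge0 => m _; exact: sqr_ge0. Qed.

Lemma dirichlet0 : dirichlet 0 = 0.
Proof.
rewrite /dirichlet big1// => m _.
have ext0 i : zero_ext 0 i = 0.
  by have := zero_ext_line 0 0 1 i; rewrite scale1r addr0; lra.
by rewrite !ext0 subrr expr0n.
Qed.

Lemma dirichletZ (s : R) v : dirichlet (s *: v) = s ^+ 2 * dirichlet v.
Proof.
rewrite -[s *: v]add0r dirichlet_line dirichlet0 add0r.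
have -> : neg_laplacian 0 = 0.
  apply/rowP => k; rewrite !mxE.
  have ext0 i : zero_ext 0 i = 0.
    by have := zero_ext_line 0 0 1 i; rewrite scale1r addr0; lra.
  by rewrite !ext0; lra.
by rewrite dotpC -(scale0r 0) dotpZr mul0r !mulr0 add0r.
Qed.

(** A discrete Poincaré inequality: starting from the boundary value 0, each coordinate is a sum of
    at most [n.+1] increments, each at most the square root of [dirichlet z]. *)
Lemma norm_le_dirichlet z : `|z| ^+ 2 <= n.+1%:R ^+ 2 * dirichlet z.
Proof.
have step m : (m <= n.+1)%N -> `|zero_ext z m| <= m%:R * Num.sqrt (dirichlet z).
  elim: m => [_|m ih mn]; first by rewrite normr0 mul0r.
  rewrite -natr1 mulrDl mul1r -[X in `|X|](subrK (zero_ext z m)) addrC.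
  rewrite (le_trans (ler_normD _ _))// lerD ?ih 1?ltnW// -sqrtr_sqr ler_sqrt.
    rewrite /dirichlet (bigD1 (Ordinal mn))//= lerDl.
    by apply: sumr_ge0 => i _; exact: sqr_ge0.
  exact: dirichlet_ge0.
rewrite -[X in _ * X]sqr_sqrtr ?dirichlet_ge0// -exprMn lerXn2r ?nnegrE ?mulr_ge0 ?sqrtr_ge0//.
have kn (k : 'I_n) : (k.+1 <= n.+1)%N by rewrite ltnS ltnW.
apply: norm_rV_le => [|k]; first by rewrite mulr_ge0// sqrtr_ge0.
rewrite -zero_ext_ord; apply: le_trans (step _ (kn k)) _.
by rewrite ler_wpM2r ?sqrtr_ge0// ler_nat ltnS ltnW.
Qed.

Lemma zero_ext_continuous m : continuous (zero_ext^~ m).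
Proof.
rewrite /zero_ext; case: m => [|i]; first exact: cst_continuous.
by case: insub => [k|]; [exact: coord_continuous|exact: cst_continuous].
Qed.

Lemma dirichlet_continuous : continuous dirichlet.
Proof.
move=> z; apply: (@cvg_sumr _ _ (nbhs z)) => m.
by apply: cvgM; apply: cvgB; exact: zero_ext_continuous.
Qed.

Lemma neg_laplacian_continuous k : continuous (fun z => neg_laplacian z 0 k).
Proof.
have -> : (fun z => neg_laplacian z 0 k) = (fun z =>
    - (zero_ext z k.+2 - 2 * zero_ext z k.+1 + zero_ext z k)).
  by apply/funext => z; rewrite mxE.
move=> z; have c m := @zero_ext_continuous m z.
rewrite /continuous_at; apply: (@cvgN _ _ _ (nbhs z)).
apply: (@cvgD _ _ _ (nbhs z)); last exact: c.
apply: (@cvgB _ _ _ (nbhs z)); first exact: c.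
by apply: (@cvgM _ _ (nbhs z)); [exact: cvg_cst|exact: c].
Qed.

(** The factor 1/2 cancels the 2 in the derivative of the quadratic form [dirichlet]. *)
Definition energy (Phi : R -> R) (H : 'I_n -> R -> R) z : R :=
  2^-1 * Phi (dirichlet z) - \sum_(k < n) H k (z 0 k).

Definition energy_grad (kappa : R -> R) (h : 'I_n -> R -> R) z : 'rV[R]_n :=
  \row_k (kappa (dirichlet z) * neg_laplacian z 0 k - h k (z 0 k)).

Lemma energy_continuous Phi H : continuous Phi -> (forall k, continuous (H k)) ->
  continuous (energy Phi H).
Proof.
move=> cPhi cH z; rewrite /continuous_at; apply: (@cvgB _ _ _ (nbhs z)).
  apply: (@cvgM _ _ (nbhs z)); first exact: cvg_cst.
  exact: (continuous_cvg _ (@cPhi _) (@dirichlet_continuous z)).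
apply: (@cvg_sumr _ _ (nbhs z)) => k.
exact: (continuous_cvg _ (@cH k _) (@coord_continuous R 1 n 0 k z)).
Qed.

Lemma cvg_rV (T : Type) (F : set_system T) {FF : Filter F} (u : T -> 'rV[R]_n)
    (a : 'rV[R]_n) :
  (forall k, (fun t => u t 0 k) @ F --> a 0 k) -> u @ F --> a.
Proof.
move=> ua; apply/cvgrPdist_le => e e0.
have : \forall t \near F, forall k, `|a 0 k - u t 0 k| <= e.
  by apply: filter_forall => k; move/cvgrPdist_le : (ua k); exact.
apply: filterS => t H; apply: norm_rV_le; first exact: ltW.
by move=> k; rewrite !mxE.
Qed.

Lemma energy_grad_continuous kappa h :
  continuous kappa -> (forall k, continuous (h k)) ->
  continuous (energy_grad kappa h).
Proof.
move=> ck ch z; apply: (@cvg_rV _ (nbhs z)) => k; rewrite mxE.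
under eq_fun do rewrite mxE.
apply: (@cvgB _ _ _ (nbhs z)); last first.
  exact: (continuous_cvg _ (@ch k _) (@coord_continuous R 1 n 0 k z)).
apply: (@cvgM _ _ (nbhs z)); last exact: neg_laplacian_continuous.
exact: (continuous_cvg _ (@ck _) (@dirichlet_continuous z)).
Qed.

Lemma energy_derive Phi kappa H h z v :
  (forall t : R, is_derive t (1 : R) Phi (kappa t)) ->
  (forall k (t : R), is_derive t (1 : R) (H k) (h k t)) ->
  is_derive z v (energy Phi H) (dotp (energy_grad kappa h z) v).
Proof.
move=> dPhi dH.
suff : is_derive (0 : R) (1 : R) (fun t => energy Phi H (z + t *: v))
    (dotp (energy_grad kappa h z) v).
  by rewrite is_derive_lineE scale0r addr0.
pose q (t : R) := dirichlet z + t * (2 * dotp (neg_laplacian z) v)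
   + t ^+ 2 * dirichlet v.
pose l (k : 'I_n) (t : R) := z 0 k + t * v 0 k.
have dq : is_derive (0 : R) (1 : R) q (2 * dotp (neg_laplacian z) v).
  exact: is_derive_quadratic.
have dl k : is_derive (0 : R) (1 : R) (l k) (v 0 k) by exact: is_derive_affine.
have q0 : q 0 = dirichlet z by rewrite /q expr0n !mul0r !addr0.
have l0 k : l k 0 = z 0 k by rewrite /l mul0r addr0.
pose w : R -> R := 2^-1 *: (Phi \o q) - \sum_(k < n) (H k \o l k).
have eqE : w = (fun t => energy Phi H (z + t *: v)).
  apply/funext => t; rewrite /w /energy !fctE fct_sumE dirichlet_line.
  by congr (_ - _); apply: eq_bigr => k _ /=; rewrite !mxE.
rewrite -eqE.
have dPq := @is_derive1_comp R Phi q 0 _ _ (dPhi (q 0)) dq.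
have dHl k := @is_derive1_comp R (H k) (l k) 0 _ _ (dH k (l k 0)) (dl k).
apply: is_derive_eq.
have -> (a b : R) : 2^-1 *: (a * (2 * b)) = a * b by rewrite /GRing.scale/=; field.
rewrite q0 /dotp mulr_sumr -sumrB; apply: eq_bigr => k _.
by rewrite [energy_grad _ _ _ _ _]mxE l0; ring.
Qed.

(** The [Phi] term contributes at least [c / 2 * dirichlet z] up to a constant. By the Poincaré
    inequality and the smallness of [A], the potential takes away at most half of this. The leading
    1 in the bound comes from [|z| <= 1 + |z| ^+ 2]. *)
Lemma energy_coercive Phi H c D A B : 0 < c -> 0 <= A -> 0 <= B ->
  (forall t, 0 <= t -> c * t - D <= Phi t) ->
  (forall k t, `|H k t| <= A * t ^+ 2 + B) ->
  n%:R * A * n.+1%:R ^+ 2 <= c / 4 ->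
  forall a z, energy Phi H z <= a ->
    `|z| <= 1 + n.+1%:R ^+ 2 * (4 / c * (a + D / 2 + n%:R * B)).
Proof.
move=> c0 A0 B0 hPhi hH hA a z.
have S0 := dirichlet_ge0 z; have hz := norm_le_dirichlet z.
have hsum : \sum_(k < n) H k (z 0 k) <= n%:R * A * `|z| ^+ 2 + n%:R * B.
  apply: (@le_trans _ _ (\sum_(k < n) (A * `|z| ^+ 2 + B))).
    apply: ler_sum => k _; apply: le_trans (ler_norm _) _.
    apply: le_trans (hH _ _) _; rewrite lerD2r ler_wpM2l//.
    by rewrite -real_normK ?num_real// lerXn2r ?nnegrE// coord_norm.
  by rewrite sumr_const card_ord -[leLHS]mulr_natl mulrDr mulrA.
have h1 : n%:R * A * `|z| ^+ 2 <= c / 4 * dirichlet z.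
  apply: (@le_trans _ _ (n%:R * A * (n.+1%:R ^+ 2 * dirichlet z))).
    by rewrite ler_wpM2l// mulr_ge0.
  by rewrite mulrA ler_wpM2r.
have := hPhi _ S0; rewrite /energy => h2 h3.
have h4 : dirichlet z <= 4 / c * (a + D / 2 + n%:R * B).
  rewrite -(ler_pM2l (_ : 0 < c / 4)); last by rewrite divr_gt0.
  rewrite mulrA mulf_div [4 * c]mulrC divff ?mul1r; first lra.
  by rewrite mulf_neq0// gt_eqF.
have h5 : `|z| ^+ 2 <= n.+1%:R ^+ 2 * (4 / c * (a + D / 2 + n%:R * B)).
  by rewrite (le_trans hz)// ler_wpM2l// exprn_ge0.
have z0 := normr_ge0 z; nra.
Qed.

Definition extend z : 'rV[R]_n.+2 := \row_i zero_ext z i.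

Lemma extend_inj : injective extend.
Proof.
move=> y z yz; apply/rowP => k.
have kn : (k.+1 < n.+2)%N by rewrite ltnS ltnW// ltnS.
move/rowP/(_ (Ordinal kn)) : yz.
by rewrite !mxE /= -!zero_ext_ord.
Qed.

Lemma extend_solution (K : R -> R) (f g : 'I_n -> R -> R) (mu : 'rV[R]_n) z :
  energy_grad K (fun k t => g k t + mu 0 k * f k t) z = 0 ->
  is_solution K f g mu (extend z).
Proof.
move=> gz; have X m : (m < n.+2)%N -> extend z 0 (inord m) = zero_ext z m.
  by move=> mn; rewrite mxE inordK.
rewrite /is_solution; split => [||k].
- by rewrite X.
- by rewrite X// zero_ext_last.
have kn : (k < n)%N by [].
have k1 : (k.+1 < n.+2)%N by rewrite ltnS (leq_trans kn).
have k2 : (k.+2 < n.+2)%N by rewrite !ltnS.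
rewrite (X _ k2) (X _ k1) (X k) ?(ltnW k1)//.
(* [is_solution] indexes an increment by its right end, [dirichlet] by its left end. *)
have -> : \sum_(1 <= m < n.+2)
    `|extend z 0 (inord m) - extend z 0 (inord m.-1)| ^+ 2 = dirichlet z.
  rewrite big_add1/= big_mkord; apply: eq_bigr => m _.
  have m1 : (m.+1 < n.+2)%N by rewrite ltnS ltn_ord.
  rewrite (X _ m1) (X m) ?(ltnW m1)//.
  by rewrite real_normK ?num_real.
move/rowP/(_ k) : gz; rewrite !mxE -(zero_ext_ord z k) => /eqP.
by rewrite subr_eq0 => /eqP <-; rewrite mulrN mulNr.
Qed.

End dirichlet_energy.

(** * Assembly: the minimax gap, its stability and the three solutions *)

(** This exhibits the affine dependence on [mu] that [two_minimizers] requires. *)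
Lemma energyD (R : realType) (n : nat) (Phi : R -> R) (G F : 'I_n -> R -> R)
    (mu z : 'rV[R]_n) :
  energy Phi (fun k t => G k t + mu 0 k * F k t) z =
  energy Phi G z - dotp mu (\row_k F k (z 0 k)).
Proof.
rewrite /energy big_split /= opprD addrA; congr (_ - _).
by apply: eq_bigr => k _; rewrite mxE.
Qed.

Lemma energyE0 (R : realType) (n : nat) (Phi : R -> R) (G : 'I_n -> R -> R)
    (z : 'rV[R]_n) :
  energy Phi G z = energy Phi (fun _ _ => 0) z - \sum_(k < n) G k (z 0 k).
Proof. by rewrite /energy [X in _ = _ - X - _]big1 ?subr0. Qed.

Lemma sum_norm_le (R : realType) (n : nat) (u : 'I_n -> R) (d : R) :
  (forall k, `|u k| <= d) -> `|\sum_(k < n) u k| <= n%:R * d.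
Proof.
move=> ud; apply: le_trans (ler_norm_sum _ _ _) _.
apply: (@le_trans _ _ (\sum_(k < n) d)); first exact: ler_sum.
by rewrite sumr_const card_ord -[leLHS]mulr_natl.
Qed.

Theorem theorem2p1 (R : realType) (n : nat) (hn : (1 <= n)%N)
    (K : R -> R) (f : 'I_n -> R -> R)
    (hK : {within `[0, +oo[, continuous K})
    (hf : forall k : 'I_n, continuous (f k))
    (ha1 : (ereal_inf [set (int0 K t)%:E | t in [set t : R | (0 < t)%R]] < 0)%E)
    (ha2 : (0 < limf_einf (fun t : R => (int0 K t / t)%:E) (pinfty_nbhs R))%E)
    (hb : forall k : 'I_n,
      (limf_esup (fun t : R => (`|int0 (f k) t| / t ^+ 2)%:E)
         (abs_infty_nbhs R) < +oo)%E)
    (hc : forall k : 'I_n,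
      (forall t : R, int0 (f k) (- t) = - int0 (f k) t) /\
      (forall t : R, int0 (f k) t = 0 <-> t = 0)) :
  forall r : R, 0 < r ->
  exists2 delta : R, 0 < delta &
    forall g : 'I_n -> R -> R,
      (forall k : 'I_n, continuous (g k)) ->
      (\big[maxe/-oo]_(k < n)
         (ereal_sup [set (int0 (g k) t)%:E | t in [set: R]]
          - ereal_inf [set (int0 (g k) t)%:E | t in [set: R]]) < delta%:E)%E ->
      exists2 mu : 'rV[R]_n, \sum_(k < n) `|mu 0 k| ^+ 2 < r ^+ 2 &
        exists x y z : 'rV[R]_n.+2,
          [/\ x != y, x != z & y != z] /\
          [/\ is_solution K f g mu x, is_solution K f g mu y
            & is_solution K f g mu z].
Proof.
move=> r r0.
(* The values of K on negative numbers play no role; this makes it continuous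
   on the whole line. *)
pose kappa (t : R) := K `|t|; pose Phi := int0 kappa; pose F k := int0 (f k).
have ckappa : continuous kappa by exact: continuous_comp_norm.
have dPhi t : is_derive t (1 : R) Phi (kappa t) by exact: int0_derive.
have cPhi : continuous Phi by exact: int0_continuous.
have PhiK t : 0 <= t -> Phi t = int0 K t by exact: int0_comp_norm.
have Phi0 : Phi 0 = 0 by exact: int0_0.
have cF k : continuous (F k) by exact: int0_continuous.
have F0 k t : F k t = 0 -> t = 0 by move/((hc k).2 t).1.
have FN k t : F k (- t) = - F k t by exact: (hc k).1.
have [c c0 [D PhiD]] : exists2 c : R, 0 < c &
    exists D : R, forall t, 0 <= t -> c * t - D <= Phi t.
  have [c c0 [T cT]] := limf_einf_gt0_bound ha2.
  exists c => //; apply: (@linear_lower_bound _ _ _ (Num.max T 0)) => // t.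
  by rewrite gt_max => /andP[/cT Tt /ltW/PhiK ->].
have [C C0 FC] : exists2 C : R, 0 <= C & forall k t, `|F k t| <= C * t ^+ 2 + C.
  have /choice[Ck CkP] k : exists C, 0 <= C /\ forall t, `|F k t| <= C * (t ^+ 2 + 1).
    by have [C C0 CP] := quadratic_bound (cF k) (hb k); exists C.
  have Ck0 k : 0 <= Ck k by exact: (CkP k).1.
  exists (\sum_k Ck k) => [|k t]; first exact: sumr_ge0.
  rewrite -[X in _ <= _ + X]mulr1 -mulrDr (le_trans ((CkP k).2 t))//.
  rewrite ler_wpM2r ?addr_ge0 ?sqr_ge0// (bigD1 k)//= lerDl.
  exact: sumr_ge0.
have n0 : (0 : R) < n.+1%:R by rewrite ltr0n.
have nn : n%:R < n.+1%:R :> R by rewrite ltr_nat.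
(* The first bound puts the cube inside the Euclidean ball of radius [r]; the second gives the
   smallness condition of [energy_coercive] with [A = rho * C]. *)
pose rho : R := Num.min (r / n.+1%:R) (c / 4 / ((C + 1) * n.+1%:R ^+ 3)).
have rho0 : 0 < rho.
  by rewrite lt_min !divr_gt0// mulr_gt0 ?exprn_gt0//; lra.
have rho_r : n%:R * rho ^+ 2 < r ^+ 2.
  have h1 : rho ^+ 2 <= (r / n.+1%:R) ^+ 2.
    have rn : 0 < r / n.+1%:R by rewrite divr_gt0.
    by rewrite lerXn2r ?nnegrE ?(ltW rn) ?(ltW rho0)// ge_min lexx.
  apply: (@le_lt_trans _ _ (n%:R * (r / n.+1%:R) ^+ 2)); first by rewrite ler_wpM2l.
  rewrite expr_div_n mulrCA gtr_pMr ?exprn_gt0// ltr_pdivrMr ?exprn_gt0// mul1r.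
  by rewrite (lt_le_trans nn)// ler_eXnr// ler1n.
have rho_c : n%:R * (rho * C) * n.+1%:R ^+ 2 <= c / 4.
  have h1 : rho * ((C + 1) * n.+1%:R ^+ 3) <= c / 4.
    by rewrite -ler_pdivlMr ?ge_min ?lexx ?orbT// mulr_gt0 ?exprn_gt0//; lra.
  apply: le_trans h1.
  have -> : n%:R * (rho * C) * n.+1%:R ^+ 2 =
    rho * ((C * n%:R) * n.+1%:R ^+ 2) by ring.
  rewrite ler_wpM2l ?(ltW rho0)// [n.+1%:R ^+ 3]exprS mulrA ler_wpM2r ?exprn_ge0//.
  by apply: ler_pM => //; lra.
(* The bound on [|z|] is uniform over the cube of parameters, as [two_minimizers] demands. *)
have coE (d : R) (G : 'I_n -> R -> R) (mu : 'rV[R]_n) : 0 <= d ->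
    (forall k t, `|G k t| <= d) -> `|mu| <= rho ->
    forall a z, energy Phi (fun k t => G k t + mu 0 k * F k t) z <= a ->
      `|z| <= 1 + n.+1%:R ^+ 2 * (4 / c * (a + D / 2 + n%:R * (rho * C + d))).
  move=> d0 Gd mu_rho; apply: (@energy_coercive R n Phi _ c D (rho * C)) => //.
  - by rewrite mulr_ge0// ltW.
  - by rewrite addr_ge0// mulr_ge0// ltW.
  - move=> k t; rewrite addrA -[rho * C * _]mulrA -mulrDr addrC.
    apply: le_trans (ler_normD _ _) _; rewrite normrM lerD//.
    by rewrite ler_pM// (le_trans (coord_norm _ _)).
pose I0 : 'rV[R]_n -> R := energy Phi (fun _ _ => 0).
have cI0 : continuous I0 by apply: energy_continuous => // k; exact: cst_continuous.
have coI0 a : exists M, forall z, I0 z <= a -> `|z| <= M.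
  eexists => z I0z; apply: (coE 0 (fun _ _ => 0) 0 (lexx 0) _ _ a).
  - by move=> k t; rewrite normr0.
  - by rewrite normr0 ltW.
  apply: le_trans I0z; rewrite /I0 /energy lerD2l lerN2.
  by apply: ler_sum => k _; rewrite mxE mul0r addr0.
have [xs xsm] := coercive_min cI0 coI0.
pose m := I0 xs.
have I0E z : I0 z = 2^-1 * Phi (dirichlet z) by rewrite /I0 /energy big1 ?subr0.
(* Some [t > 0] has [int0 K t < 0]; a constant vector is rescaled so that its Dirichlet energy is
   exactly [t]. *)
have m0 : m < 0.
  have [_ [t /= t0 <-] Kt] := ereal_inf_lt ha1.
  pose v : 'rV[R]_n := const_mx 1.
  have Dv : 0 < dirichlet v.
    have v1 : 0 < `|v|.
      by rewrite (lt_le_trans _ (coord_norm v (Ordinal hn)))// mxE normr1.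
    have := norm_le_dirichlet v; have := exprn_gt0 2 v1 => v2 /(lt_le_trans v2).
    by rewrite pmulr_rgt0// exprn_gt0.
  apply: (le_lt_trans (xsm (Num.sqrt (t / dirichlet v) *: v))).
  rewrite I0E dirichletZ sqr_sqrtr ?divr_ge0 ?ltW// divfK ?gt_eqF//.
  by rewrite PhiK ?ltW// pmulr_rlt0 ?invr_gt0// -lte_fin.
(* The maximum over the cube of the energies with [g = 0]. *)
pose J z := I0 z + rho * \sum_(k < n) `|F k (z 0 k)|.
have cJ : continuous J.
  move=> z; rewrite /continuous_at /J; apply: (@cvgD _ _ _ (nbhs z)); first exact: cI0.
  apply: (@cvgM _ _ (nbhs z)); first exact: cvg_cst.
  apply: (@cvg_sumr _ _ (nbhs z)) => k; apply: (@cvg_norm _ _ _ (nbhs z)).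
  exact: (continuous_cvg _ (@cF k _) (@coord_continuous R 1 n 0 k z)).
have sumF_ge0 z : 0 <= rho * \sum_(k < n) `|F k (z 0 k)|.
  by rewrite mulr_ge0 ?sumr_ge0// ltW.
have coJ a : exists M, forall z, J z <= a -> `|z| <= M.
  have [M MP] := coI0 a; exists M => z Jz; apply: MP; apply: le_trans Jz.
  by rewrite /J lerDl.
have [w wm] := coercive_min cJ coJ.
(* If some [F k (w 0 k)] is nonzero, then [J w > I0 w >= m]; otherwise [w = 0] and
   [J w >= 0 > m]. *)
have mw : m < J w.
  have [w0|] := eqVneq (\sum_(k < n) `|F k (w 0 k)|) 0; last first.
    move=> w0; rewrite (le_lt_trans (xsm w))// /J ltrDl mulr_gt0//.
    by rewrite lt_neqAle eq_sym w0 sumr_ge0.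
  suff -> : w = 0 by rewrite (lt_le_trans m0)// /J I0E dirichlet0 Phi0 mulr0 add0r.
  apply/rowP => k; rewrite mxE; apply: (F0 k); apply/eqP; rewrite -normr_eq0.
  by move/eqP : w0; rewrite psumr_eq0// => /allP/(_ k); apply; rewrite mem_index_enum.
(* The perturbation shifts every energy by at most [n%:R * delta], so both sides of the gap together
   lose less than its width [J w - m]. *)
pose delta := (J w - m) / (2 * n.+1%:R).
have delta0 : 0 < delta by rewrite divr_gt0 ?mulr_gt0// subr_gt0.
have ndelta : 2 * (n%:R * delta) < J w - m.
  have -> : J w - m = 2 * (n.+1%:R * delta) by rewrite /delta; field; rewrite gt_eqF.
  by rewrite ltr_pM2l// ltr_pM2r.
exists delta => // g cg /oscillation_bound gd.
pose G k := int0 (g k).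
have cG k : continuous (G k) by exact: int0_continuous.
pose P (z : 'rV[R]_n) : 'rV[R]_n := \row_k F k (z 0 k).
have cP : continuous P.
  move=> z; apply: (@cvg_rV _ _ _ (nbhs z)) => k; rewrite mxE.
  under eq_fun do rewrite mxE.
  exact: (continuous_cvg _ (@cF k _) (@coord_continuous R 1 n 0 k z)).
have hE (mu z : 'rV[R]_n) : energy Phi G z - dotp mu (P z)
    = energy Phi (fun k t => G k t + mu 0 k * F k t) z by rewrite energyD.
have Gd (z : 'rV[R]_n) : `|\sum_(k < n) G k (z 0 k)| <= n%:R * delta.
  by apply: sum_norm_le => k; exact: gd.
have [mu mu_rho [x [y [xy xm ym]]]] : exists2 mu : 'rV[R]_n, `|mu| <= rho &
  exists x y, [/\ x != y,
    forall z, energy Phi G x - dotp mu (P x) <= energy Phi G z - dotp mu (P z) &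
    forall z, energy Phi G y - dotp mu (P y) <= energy Phi G z - dotp mu (P z)].
  apply: (@two_minimizers R n _ P rho (m + n%:R * delta)) => //.
  - exact: energy_continuous.
  - move=> a; eexists => mu z mu_rho; rewrite hE.
    exact: (coE delta G mu (ltW delta0) gd mu_rho).
  - move=> mu mu_rho.
    have PN z : P (- z) = -1 *: P z.
      by apply/rowP => k; rewrite !mxE FN mulN1r.
    have I0N z : I0 (- z) = I0 z.
      by rewrite !I0E -scaleN1r dirichletZ sqrrN expr1n mul1r.
    (* [xs] and [- xs] have the same unperturbed energy and opposite [P], so for one of them the
       [mu] term does not raise the energy. *)
    have [d0|d0] := leP 0 (dotp mu (P xs)).
      exists xs; rewrite energyE0 -/(I0 xs) -/m.
      by have := Gd xs; rewrite ler_norml => /andP[? ?]; lra.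
    exists (- xs); rewrite energyE0 PN dotpZr -/(I0 (- xs)) I0N -/m.
    by have := Gd (- xs); rewrite ler_norml => /andP[? ?]; lra.
  - move=> z; rewrite energyE0 -/(I0 z).
    have -> : \sum_(k < n) `|P z 0 k| = \sum_(k < n) `|F k (z 0 k)|.
      by apply: eq_bigr => k _; rewrite mxE.
    have := wm z; rewrite {2}/J; have := Gd z; rewrite ler_norml => /andP[? ?]; lra.
pose H k t := G k t + mu 0 k * F k t.
pose h k t := g k t + mu 0 k * f k t.
have dH k (t : R) : is_derive t (1 : R) (H k) (h k t).
  have d := is_deriveD (int0_derive t (cg k)) (is_deriveZ (mu 0 k) (int0_derive t (hf k))).
  exact: d.
have cH k : continuous (H k).
  by move=> t; apply: differentiable_continuous; apply/derivable1_diffP; case: (dH k t).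
have ch k : continuous (h k).
  move=> t; rewrite /continuous_at; apply: (@cvgD _ _ _ (nbhs t)); first exact: cg.
  by apply: (@cvgM _ _ (nbhs t)); [exact: cvg_cst|exact: hf].
have dE z v := energy_derive z v dPhi dH.
have xm' z : energy Phi H x <= energy Phi H z by rewrite -!hE.
have ym' z : energy Phi H y <= energy Phi H z by rewrite -!hE.
have [||a|z [zx zy gz]] := third_critical_point dE _ _ _ xy xm' ym'.
- exact: energy_continuous.
- exact: energy_grad_continuous.
- by eexists => z; exact: (coE delta G mu (ltW delta0) gd mu_rho).
exists mu.
  apply: le_lt_trans rho_r; apply: (@le_trans _ _ (\sum_(k < n) rho ^+ 2)); last first.
    by rewrite sumr_const card_ord -[leLHS]mulr_natl.
  apply: ler_sum => k _; rewrite lerXn2r ?nnegrE ?(ltW rho0)//.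
  exact: le_trans (coord_norm _ _) mu_rho.
have sol u : energy_grad kappa h u = 0 -> is_solution K f g mu (extend u).
  move=> gu; apply: extend_solution; rewrite -gu; apply/rowP => k.
  by rewrite !mxE /kappa ger0_norm// dirichlet_ge0.
exists (extend x), (extend y), (extend z).
have inj := @extend_inj R n.
split; split; rewrite ?(inj_eq inj)// 1?eq_sym//.
- by apply: sol; exact: (grad_min dE xm').
- by apply: sol; exact: (grad_min dE ym').
- exact: sol.
Qed.
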